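(* Let $X$ be an infinite densely totally ordered set such that any two nonempty convex subsets of $X$ having no minimum and no maximum are order-isomorphic. Suppose that $X$ has a minimum but no maximum. Then $\operatorname{rank}(\mathcal{OP}(X):\mathcal{O}(X)) = 1$.
   Context: Let $(X,\le)$ be a totally ordered set. The order is dense if for all $x<y$ in $X$ there is $z\in X$ with $x<z<y$. A subset $C\subseteq X$ is convex if $x,y\in C$, $z\in X$ and $x<z<y$ imply $z\in C$. Two subchains are order-isomorphic if there is an order-preserving bijection between them. $\mathcal{T}(X)$ is the monoid of all maps $X\to X$ under composition; maps are written on the right, so $x(\alpha\beta)=(x\alpha)\beta$. A map $f$ from a subchain of $X$ into $X$ is order-preserving if $x\le y$ implies $xf\le yf$. $\mathcal{O}(X)$ is the submonoid of all order-preserving $\alpha\in\mathcal{T}(X)$. A transformation $\alpha\in\mathcal{T}(X)$ is orientation-preserving if there is a nonempty subset $X_1\subseteq X$ such that, with $X_2=X\setminus X_1$ (possibly empty): (1) $\alpha$ is order-preserving on $X_1$ and on $X_2$; (2) for all $p\in X_1$ and $q\in X_2$ we have $p<q$ and $p\alpha\ge q\alpha$. $\mathcal{OP}(X)$ is the semigroup of all orientation-preserving transformations of $X$; it contains $\mathcal{O}(X)$. For a semigroup $S$ and a subset $A\subseteq S$, the relative rank $\operatorname{rank}(S:A)$ is the minimal cardinality of a set $B\subseteq S$ such that $A\cup B$ generates $S$. *)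

(* Defs.v *)
From HB Require Import structures.
From mathcomp Require Import all_boot all_order.
From mathcomp Require Import all_classical.

Set Implicit Arguments.
Unset Strict Implicit.
Unset Printing Implicit Defensive.

Local Open Scope classical_set_scope.

Section RelativeRank.
Variable G : semigroupType.
Implicit Types S A B : set G.

Definition subsemigroup : set (set G) :=
  [set M | forall x y, M x -> M y -> M (x * y)%g].

Definition generates B S := smallest subsemigroup B = S.

(* The rank is a cardinal, so it is given by comparison with a set [K]:
   rank(S : A) = #|K|.  A semigroup [S] is a subset of an ambient semigroup
   closed under the product; [generates _ S] entails this closure. *)
Definition has_relrank (U : Type) S A (K : set U) :=
  (exists B, [/\ B `<=` S, generates (A `|` B) S & (B #= K)%card]) /\
  (forall B, B `<=` S -> generates (A `|` B) S -> (K #<= B)%card).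

End RelativeRank.

(* An alias of [X -> X], so that it carries the monoid law below. *)
Definition transf (X : choiceType) : Type := X -> X.

Section Transf.
Variable X : choiceType.

HB.instance Definition _ := Choice.copy (transf X) (X -> X).

(* Maps act on the right: x (a * b) = (x a) b. *)
Definition transf_mul (a b : transf X) : transf X := b \o a.

Let transf_mulA : associative transf_mul. Proof. by []. Qed.
Let transf_mul1 : left_id (idfun : transf X) transf_mul. Proof. by []. Qed.
Let transf_1mul : right_id (idfun : transf X) transf_mul. Proof. by []. Qed.

HB.instance Definition _ :=
  isMonoid.Build (transf X) transf_mulA transf_mul1 transf_1mul.

End Transf.

Section Chains.
Local Open Scope order_scope.
Variables (d : Order.disp_t) (X : orderType d).
Implicit Types (C D : set X) (f : X -> X) (a : transf X).

Definition densely_ordered := forall x y : X, x < y -> exists z, x < z < y.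

Definition convex_subset C :=
  forall x y z, C x -> C y -> x < z < y -> C z.

Definition has_minimum C := exists2 m, C m & lbound C m.
Definition has_maximum C := exists2 m, C m & ubound C m.

Definition order_preserving_on D f := {in D &, {homo f : x y / x <= y}}.

(* Only the restriction of [f] to [C] matters. *)
Definition order_isomorphic C D :=
  exists2 f : X -> X, set_bij C D f & order_preserving_on C f.

Definition order_preserving : set (transf X) :=
  [set a | {homo a : x y / x <= y}].

Definition orientation_preserving : set (transf X) :=
  [set a | exists X1 : set X,
    [/\ X1 !=set0,
        order_preserving_on X1 a,
        order_preserving_on (~` X1) a &
        forall p q, X1 p -> (~` X1) q -> p < q /\ a q <= a p]].

End Chains.

Arguments densely_ordered {d} X.
Arguments order_preserving {d} X.
Arguments orientation_preserving {d} X.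

(* Main.v *)
(** Fix [c > min X].  Both [[min X, c)] and [[c, oo)] are isomorphic to [X], so
    some bijection [swap] exchanges them; it is orientation-preserving with cut
    at [c].  Given an orientation-preserving [b] with cut [(X1, X2)], embed [X1]
    into [[min X, c)] and [X2] onto a final segment of [[c, oo)], apply [swap],
    and then act as [b] does on the image.  This last map extends monotonically
    to [X] without any completeness: what lies below the image goes to [min X],
    and what lies above is retracted onto the image of [X1], which is either
    cofinal (if [X1] has no maximum) or has a maximum itself. *)

Require Import Defs.
From mathcomp Require Import all_boot all_order.
From mathcomp Require Import all_classical.

Import Order.TTheory.

Local Open Scope classical_set_scope.

(** * Cuts of orientation-preserving maps and closure under composition *)

Section Orientation.
Set Implicit Arguments.
Unset Strict Implicit.
Local Open Scope order_scope.
Context {d : Order.disp_t} {X : orderType d}.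
Implicit Types (C D : set X) (P Q : pred X) (f g : X -> X).

Lemma order_preserving_onP C f :
  order_preserving_on C f <->
  forall x y, C x -> C y -> x <= y -> f x <= f y.
Proof.
split=> h x y; first by move=> Cx Cy; apply: h; rewrite inE.
by rewrite !inE; apply: h.
Qed.

(** [P] is the indicator of the initial part [X1], boolean so that cuts can be combined by [||] and
    [&&] and split by cases. *)
Definition oriented_by P f := forall x y, x <= y ->
  [/\ P y -> P x, P x = P y -> f x <= f y & P x -> ~~ P y -> f y <= f x].

(* [P] is allowed to be empty here, unlike [X1] in [orientation_preserving]. *)
Lemma orientation_preservingP (x0 : X) (a : transf X) :
  orientation_preserving X a <-> exists P, oriented_by P a.
Proof.
split=> [[X1 [_ /order_preserving_onP h1 /order_preserving_onP h2 h12]]|[P hP]].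
  exists (fun x => `[< X1 x >]) => x y xy; split.
  - move=> /asboolP Y; apply/asboolP; apply: contrapT => nX.
    by have [] := h12 _ _ Y nX; rewrite ltNge xy.
  - case: (asboolP (X1 x)); case: (asboolP (X1 y)) => // Y Z _; first exact: h1.
    exact: h2.
  - by move=> /asboolP Z /asboolPn Y; have [] := h12 _ _ Z Y.
have [[p Pp]|noP] := pselect (exists p, P p).
  exists [set x | P x]; split; first by exists p.
  - apply/order_preserving_onP => x y /= Px Py /hP[_ + _]; apply.
    by rewrite Px Py.
  - apply/order_preserving_onP => x y /= /negP Px /negP Py /hP[_ + _]; apply.
    by rewrite (negPf Px) (negPf Py).
  - move=> x y /= Px /negP Py; case: (leP y x) => [/hP[/(_ Px)]|xy].
      by rewrite (negPf Py).
    by have [_ _ ->] := hP _ _ (ltW xy).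
(* An empty [P] makes [a] monotone, so all of [X] can serve as [X1]. *)
have P0 x : P x = false by apply/negP => Px; apply: noP; exists x.
exists setT; split; first by exists x0.
- by apply/order_preserving_onP => x y _ _ /hP[_ + _]; apply; rewrite !P0.
- by apply/order_preserving_onP => x y /(_ I).
- by move=> x y _ /(_ I).
Qed.

Lemma order_preserving_orientation (x0 : X) :
  order_preserving X `<=` orientation_preserving X.
Proof.
move=> a ha; apply/(orientation_preservingP x0); exists xpredT => x y xy.
by split=> // _; apply: ha.
Qed.

Lemma order_preserving_subsemigroup :
  subsemigroup (order_preserving X : set (transf X)).
Proof. by move=> a b ha hb x y xy; apply/hb/ha. Qed.

(** The composite falls at most once: where the fall of [f] leads from outside [Q] back into [Q],
    the map [g] turns it into a rise. *)
Lemma oriented_by_comp P Q f g : oriented_by P f -> oriented_by Q g ->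
  exists R, oriented_by R (g \o f).
Proof.
move=> hf hg.
have [[z [nPz nQz]]|none] := pselect (exists z, ~~ P z /\ ~~ Q (f z)).
  (* [f] sends [P] above [f z], hence outside [Q]. Only the points outside [P] with image outside
     [Q] then go past the new cut. *)
  have PQ x : P x -> Q (f x) = false.
    move=> Px; apply: contraNF nQz; have [zx|/ltW xz] := leP z x.
      by have [/(_ Px)] := hf _ _ zx; rewrite (negPf nPz).
    have [_ _ /(_ Px nPz) fzx] := hf _ _ xz.
    by have [] := hg _ _ fzx.
  exists (fun x => P x || Q (f x)) => x y /hf[].
  case: (boolP (P x)) (PQ x); case: (boolP (P y)) (PQ y) => //=.
  - move=> _ /(_ isT) Qy _ /(_ isT) Qx _ /(_ erefl)/hg[_ + _] _.
    by rewrite Qx Qy; split; auto.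
  - move=> _ _ _ /(_ isT) Qx _ _ /(_ isT isT)/hg[_].
    by rewrite Qx; case: (Q (f y)); split; auto.
  - by move=> _ _ _ _ /(_ isT).
  - by move=> _ _ _ _ _ /(_ erefl)/hg[].
have PQ x : P x = false -> Q (f x).
  by move=> Px; apply: contrapT => /negP nQ; apply: none; exists x; rewrite Px.
(* Points outside [P] all land in [Q], where [g] is highest, so they continue the rise begun by the
   points of [P] landing outside [Q]. *)
exists (fun x => P x && Q (f x)) => x y /hf[].
case Px: (P x) (PQ x); case Py: (P y) (PQ y) => //=.
- by move=> _ _ _ /(_ erefl)/hg[].
- move=> /(_ erefl) Qy _ _ _ /(_ isT isT)/hg[_].
  by rewrite Qy; case: (Q (f x)); split; auto.
- by move=> _ _ /(_ isT).
- move=> /(_ erefl) Qy /(_ erefl) Qx _ /(_ erefl)/hg[_ + _] _.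
  by rewrite Qx Qy; split; auto.
Qed.

Lemma orientation_preserving_subsemigroup (x0 : X) :
  subsemigroup (orientation_preserving X : set (transf X)).
Proof.
move=> a b /(orientation_preservingP x0)[P hP].
move=> /(orientation_preservingP x0)[Q hQ].
have [R hR] := oriented_by_comp hP hQ.
by apply/(orientation_preservingP x0); exists R.
Qed.

End Orientation.

(** * Isomorphisms between convex subsets that have a minimum *)

Section Isomorphisms.
Set Implicit Arguments.
Unset Strict Implicit.
Local Open Scope order_scope.
Context {d : Order.disp_t} {X : orderType d}.
Implicit Types (C D : set X) (f g : X -> X).

Definition inverse_isomorphisms C D f g :=
  [/\ forall x, C x -> D (f x) /\ g (f x) = x,
      forall y, D y -> C (g y) /\ f (g y) = y,
      forall x y, C x -> C y -> x <= y -> f x <= f y &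
      forall x y, D x -> D y -> x <= y -> g x <= g y].

Lemma inverse_isomorphismsI C D f : set_bij C D f ->
  (forall x y, C x -> C y -> x <= y -> f x <= f y) ->
  exists g, inverse_isomorphisms C D f g.
Proof.
move=> [fCD finj fsurj] fle.
pose g y := xget y [set x | C x /\ f x = y].
have gP y : D y -> C (g y) /\ f (g y) = y.
  by move=> /fsurj[x Cx fx]; apply: (@xgetPex _ y [set x | C x /\ f x = y]); exists x.
exists g; split=> // [x Cx|x y Dx Dy xy].
  split; first exact: fCD.
  have [Cg fg] := gP _ (fCD _ Cx).
  by apply: finj; rewrite ?inE.
have [Cx fx] := gP _ Dx; have [Cy fy] := gP _ Dy.
rewrite leNgt; apply/negP => gyx.
have := fle _ _ Cy Cx (ltW gyx); rewrite fx fy => yx.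
by move: gyx; rewrite (@le_anti _ _ x y) ?ltxx // xy.
Qed.

(** [p] is the minimum of [C], named so that isomorphisms can match minima explicitly. *)
Definition left_closed C p := C p /\ lbound C p.

(** Deleting the minima leaves convex sets without endpoints, which the hypothesis identifies;
    sending [p] to [q] extends that isomorphism, and its inverse likewise. *)
Lemma left_closed_isomorphisms (X_dense : densely_ordered X)
  (X_convex_iso : forall C D : set X,
    C !=set0 -> convex_subset C -> ~ has_minimum C -> ~ has_maximum C ->
    D !=set0 -> convex_subset D -> ~ has_minimum D -> ~ has_maximum D ->
    order_isomorphic C D) C D p q :
  convex_subset C -> left_closed C p -> ~ has_maximum C ->
  convex_subset D -> left_closed D q -> ~ has_maximum D ->
  exists f g, inverse_isomorphisms C D f g.
Proof.
move=> Ccvx Cp Cmax Dcvx Dq Dmax.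
(* Density keeps a new minimum from appearing when [r] is deleted; were [r] the only point, it would
   be a maximum. *)
have interior E r : convex_subset E -> left_closed E r -> ~ has_maximum E ->
    [/\ E `\ r !=set0, convex_subset (E `\ r),
        ~ has_minimum (E `\ r) & ~ has_maximum (E `\ r)].
  move=> Ecvx [Er Eler] Emax.
  have [s [Es sr]] : E `\ r !=set0.
    apply: contrapT => E0; apply: Emax; exists r => // x Ex.
    by rewrite leNgt; apply/negP => rx; apply: E0; exists x; split=> // xr;
      rewrite xr ltxx in rx.
  split; first by exists s.
  - move=> x y z [Ex _] [Ey _] xzy; split; first exact: Ecvx xzy.
    by move=> zr; move: xzy; rewrite zr ltNge (Eler _ Ex).
  - move=> [m [Em mr] mle].
    have rm : r < m by rewrite lt_neqAle Eler // andbT eq_sym; apply/eqP.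
    have [z rzm] := X_dense _ _ rm; have /andP[rz zm] := rzm.
    have : m <= z.
      apply: mle; split; first exact: Ecvx rzm.
      by move=> zr; rewrite zr ltxx in rz.
    by rewrite leNgt zm.
  - move=> [m [Em _] mge]; apply: Emax; exists m => // x Ex.
    by have [->|/eqP xr] := eqVneq x r; [exact: Eler|exact: mge].
have [C0 Cc Cm CM] := interior C p Ccvx Cp Cmax.
have [D0 Dc Dm DM] := interior D q Dcvx Dq Dmax.
have [f fbij /order_preserving_onP fle] := X_convex_iso _ _ C0 Cc Cm CM D0 Dc Dm DM.
have [g [fP gP _ gle]] := inverse_isomorphismsI fbij fle.
(* Stated for one direction, so that it serves both [f] and its inverse [g]. *)
have extend E F r s h :
    left_closed E r -> left_closed F s ->
    (forall x, (E `\ r) x -> (F `\ s) (h x)) ->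
    (forall x y, (E `\ r) x -> (E `\ r) y -> x <= y -> h x <= h y) ->
    let h' x := if x == r then s else h x in
    (forall x, E x -> F (h' x)) /\
    (forall x y, E x -> E y -> x <= y -> h' x <= h' y).
  move=> [Er Eler] [Fs Fles] hEF hle h'; rewrite /h'; split=> [x|x y] Ex.
    by case: eqVneq => [//|/eqP xr]; have [] := hEF x (conj Ex xr).
  move=> Ey xy; case: (eqVneq x r) => [_|/eqP xr]; case: (eqVneq y r) => [yr|/eqP yr] //.
  - by apply: Fles; have [] := hEF y (conj Ey yr).
  - by case: xr; apply: le_anti; rewrite -yr xy yr Eler.
  - exact: hle.
have [fCD fle'] := extend C D p q f Cp Dq (fun x h => (fP x h).1) fle.
have [gDC gle'] := extend D C q p g Dq Cp (fun x h => (gP x h).1) gle.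
exists (fun x => if x == p then q else f x), (fun x => if x == q then p else g x).
split=> // [x Cx|y Dy]; split; do ?[exact: fCD|exact: gDC].
  case: (eqVneq x p) => [->|/eqP xp]; first by rewrite eqxx.
  by have [[_ /eqP/negPf->]] := fP x (conj Cx xp).
case: (eqVneq y q) => [->|/eqP yq]; first by rewrite eqxx.
by have [[_ /eqP/negPf->]] := gP y (conj Dy yq).
Qed.

End Isomorphisms.

(** * Generation by one map besides the monotone ones, and the lower bound *)

Theorem theorem13 (d : Order.disp_t) (X : orderType d)
  (X_infinite : infinite_set [set: X])
  (X_dense : densely_ordered X)
  (X_convex_iso : forall C D : set X,
    C !=set0 -> convex_subset C -> ~ has_minimum C -> ~ has_maximum C ->
    D !=set0 -> convex_subset D -> ~ has_minimum D -> ~ has_maximum D ->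
    order_isomorphic C D)
  (X_min : has_minimum [set: X])
  (X_nomax : ~ has_maximum [set: X]) :
  has_relrank (orientation_preserving X) (order_preserving X) `I_1.
Proof.
have [o _ oP] := X_min.
have {}oP x : (o <= x)%O by apply: oP.
have [c oc] : exists c, (o < c)%O.
  apply: contrapT => noc; apply: X_nomax; exists o => // x _.
  by rewrite leNgt; apply/negP => ox; apply: noc; exists x.
have setTc : convex_subset [set: X] by [].
have setTl : left_closed [set: X] o by split=> // x _; exact: oP.
have [f [f' [fP f'P fle f'le]]] :
    exists f f', inverse_isomorphisms [set: X] [set x | (x < c)%O] f f'.
  apply: (left_closed_isomorphisms X_dense X_convex_iso (p := o) (q := o)) => //.
  - by move=> x y z /= _ yc /andP[_ /lt_trans]; apply.
  - by split=> // x _; exact: oP.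
  - move=> [m /= mc mmax]; have [z /andP[mz zc]] := X_dense _ _ mc.
    by have := mmax z zc; rewrite leNgt mz.
have [g [g' [gP g'P gle g'le]]] :
    exists g g', inverse_isomorphisms [set: X] [set x | (c <= x)%O] g g'.
  apply: (left_closed_isomorphisms X_dense X_convex_iso (p := o) (q := c)) => //.
  - by move=> x y z /= cx _ /andP[/ltW xz _]; apply: le_trans xz.
  - by split=> /=.
  - move=> [m /= cm mmax]; apply: X_nomax; exists m => // x _.
    by have [/mmax//|/ltW xc] := leP c x; apply: le_trans cm.
have {}fP x := fP x I; have {}gP x := gP x I.
have {}fle x y := fle x y I I; have {}gle x y := gle x y I I.
pose swap : transf X := fun x => if (x < c)%O then g (f' x) else f (g' x).
have swap_op : orientation_preserving X swap.
  apply/(orientation_preservingP o); exists (fun x => (x < c)%O) => x y xy.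
  split=> [|e|xc yc]; first exact: le_lt_trans.
    rewrite /swap e; case: (ltP y c) e => [yc xc|cy /negbT xc].
      by apply: gle; apply: f'le.
    by apply: fle; apply: g'le => //=; rewrite leNgt.
  rewrite /swap xc (negPf yc); apply: ltW; rewrite -leNgt in yc.
  by apply: lt_le_trans (gP _).1; exact: (fP _).1.
split.
  exists [set swap]; split; [by move=> _ ->| |exact: card_set1].
  apply/seteqP; split.
    apply: smallest_sub; first exact: orientation_preserving_subsemigroup.
    by move=> a [|->//]; apply: order_preserving_orientation.
  move=> b /(orientation_preservingP o)[P hP] M [Mmul Msub].
  have Pdown x y : (x <= y)%O -> P y -> P x by case/hP.
  (* A cut that misses the minimum is empty, and [b] is then monotone. *)
  have [Po|nPo] := boolP (P o); last first.
    have P0 x : P x = false by apply: contraNF nPo; apply: Pdown.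
    by apply: Msub; left => x y /hP[_ + _]; apply; rewrite !P0.
  (* [theta] embeds [P] in [X], and [rho] is a monotone left inverse defined everywhere: truncation
     at the maximum of [P] if there is one, otherwise an isomorphism from [X] to [P]. *)
  have [theta [rho [thetaP rhoP thetale rhole]]] : exists theta rho : X -> X,
      [/\ forall x, P x -> rho (theta x) = x, forall x, P (rho x),
          forall x y, P x -> P y -> (x <= y)%O -> (theta x <= theta y)%O &
          forall x y, (x <= y)%O -> (rho x <= rho y)%O].
    have [[m /= Pm mmax]|nomax] := pselect (has_maximum [set x | P x]).
      exists id, (fun x => Order.min x m); split=> // [x Px|x|x y xy].
      - by apply/min_idPl; apply: mmax.
      - by apply: Pdown Pm; rewrite ge_min lexx orbT.
      - by rewrite le_min !ge_min xy lexx orbT.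
    have [theta [rho [h1 h2 h3 h4]]] :
        exists h k, inverse_isomorphisms [set x | P x] [set: X] h k.
      apply: (left_closed_isomorphisms X_dense X_convex_iso (p := o) (q := o)) => //.
        by move=> x y z /= _ Py /andP[_ /ltW zy]; apply: Pdown Py.
      by split=> // x _; exact: oP.
    exists theta, rho; split=> // [x /h1[]//|x|x y].
      by have [] := h2 x I.
    exact: h4.
  pose gamma : transf X := fun x => if P x then f (theta x) else g x.
  (* After [gamma] and [swap], a point [x] outside [P] sits at [f x], below [c], and a point of [P]
     at [g (theta x)]. No point reaches the places given the value [o], which is chosen to keep
     [delta] monotone. *)
  pose delta : transf X := fun y => if (y < c)%O then
    (if P (f' y) then o else b (f' y)) else b (rho (g' y)).
  have bE : b = (gamma * swap * delta)%g.
    apply/funext => x; change (b x = delta (swap (gamma x))).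
    rewrite /gamma; case: ifPn => Px.
      have [fc ff'] := fP (theta x); have [gc gg'] := gP (theta x).
      by rewrite /swap fc ff' /delta ltNge gc gg' thetaP.
    have [gc gg'] := gP x; have [fc ff'] := fP x.
    by rewrite /swap ltNge gc gg' /delta fc ff' (negPf Px).
  have gamma_le : order_preserving X gamma.
    move=> x y xy; rewrite /gamma.
    case: (boolP (P x)) => Px; case: (boolP (P y)) => Py.
    - by apply: fle; apply: thetale.
    - exact: ltW (lt_le_trans (fP _).1 (gP _).1).
    - by rewrite (Pdown _ _ xy Py) in Px.
    - exact: gle.
  have delta_le : order_preserving X delta.
    move=> x y xy; rewrite /delta; case: (ltP x c) => xc; case: (ltP y c) => yc.
    - have fxy := f'le _ _ xc yc xy.
      case: ifPn => // Px; rewrite ifN; last by apply: contra Px; apply: Pdown.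
      have [_ + _] := hP _ _ fxy; apply; rewrite (negPf Px).
      by apply/esym/negbTE; apply: contra Px; apply: Pdown.
    (* The fall of [b] across its cut becomes a rise of [delta], because [swap] has exchanged the
       two sides. *)
    - case: ifPn => // Px.
      have [xy'|/ltW yx'] := leP (f' x) (rho (g' y)).
        by rewrite (Pdown _ _ xy') in Px.
      by have [_ _ ->] := hP _ _ yx'.
    - by move: (le_lt_trans (le_trans xc xy) yc); rewrite ltxx.
    - have [_ + _] := hP _ _ (rhole _ _ (g'le _ _ xc yc xy)).
      by apply; rewrite !rhoP.
  by rewrite bE; apply: (Mmul); [apply: (Mmul)|]; apply: Msub; [left|right|left].
move=> B _ gB.
(* A nonempty [B] contains a singleton, so only the empty one has to be excluded. *)
have [[b Bb]|B0] := pselect (B !=set0).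
  rewrite -(card_le_eql (card_set1 (x := b))).
  by apply: subset_card_le => _ ->.
(* This map falls from [c] to [o] past [c]: it is orientation-preserving but not monotone, whereas
   an empty [B] yields monotone maps only. *)
pose a : transf X := fun x => if (x <= c)%O then c else o.
have aop : orientation_preserving X a.
  apply/(orientation_preservingP o); exists (fun x => (x <= c)%O) => x y xy.
  rewrite /a; split=> [|->//|-> /negPf->//]; exact: le_trans.
have /(_ _ aop) amono : orientation_preserving X `<=` order_preserving X.
  rewrite -gB; apply: smallest_sub; first exact: order_preserving_subsemigroup.
  by move=> z [//|Bz]; case: B0; exists z.
have [z cz] : exists z, (c < z)%O.
  apply: contrapT => noz; apply: X_nomax; exists c => // x _.
  by rewrite leNgt; apply/negP => cx; apply: noz; exists x.
have := amono o z (oP z).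
by rewrite /a (oP c) [(z <= c)%O]leNgt cz leNgt oc.
Qed.
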